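(* Let $\alpha\geq 5$ be an integer and let $\mathcal{G}_{\alpha}$ be any hereditary class of graphs (every subgraph of a graph in $\mathcal{G}_{\alpha}$ belongs to $\mathcal{G}_{\alpha}$) such that every graph $G\in\mathcal{G}_{\alpha}$ has minimum degree at most $1$, or contains an edge $uv$ with $d_G(u)+d_G(v)\leq \alpha$, or contains a 2-alternating cycle. Then every graph $G\in\mathcal{G}_{\alpha}$ can be edge-partitioned into two forests $F_1$, $F_2$ and a subgraph $H$ (i.e. $E(G)$ is the disjoint union of $E(F_1)$, $E(F_2)$, $E(H)$) such that $d_{F_i}(v)\leq \max\{2,\lceil\frac{d_G(v)-\alpha+6}{2}\rceil\}$ for every vertex $v$ of $F_i$, $i=1,2$, and $\Delta(H)\leq \alpha-5$.
   Context: Graphs are finite and simple. $d_G(v)$ denotes the degree of $v$ in $G$ (similarly $d_{F_i}(v)$ in $F_i$), and $\Delta(\cdot)$ denotes maximum degree. A 2-alternating cycle in $G$ is a cycle $v_0v_1\cdots v_{2n-1}v_0$ (with $n\geq 2$) such that $d_G(v_0)=d_G(v_2)=\cdots=d_G(v_{2n-2})=2$. *)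

(* Defs.v *)
From HB Require Import structures.
From mathcomp Require Import all_boot all_order all_algebra.

Set Implicit Arguments.
Unset Strict Implicit.
Unset Printing Implicit Defensive.

(* A graph has an ambient finite type T and a vertex set inside T, so
   that a graph and its subgraphs have the same type. *)
Record graph (T : finType) := Graph {
  vertices : {set T};
  edges : {set {set T}};
  edgesP : [forall e in edges, (e \subset vertices) && (#|e| == 2)] }.

Definition adj (T : finType) (G : graph T) : rel T :=
  fun u v => [set u; v] \in edges G.

Definition deg (T : finType) (G : graph T) (v : T) : nat :=
  #|[set u | adj G v u]|.

(* Every degree is less than the number of vertices, so the default value of
   the iterated minimum only matters for the graph without vertices, whose
   minimum degree is thus 0. *)
Definition min_deg (T : finType) (G : graph T) : nat :=
  \big[minn/#|vertices G|]_(v in vertices G) deg G v.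

Definition max_deg (T : finType) (G : graph T) : nat :=
  \max_(v in vertices G) deg G v.

Definition subgraph (T : finType) (H G : graph T) : bool :=
  (vertices H \subset vertices G) && (edges H \subset edges G).

(* The bound on the size excludes the 2-cycles u, v that ucycle accepts for
   every edge uv, and the empty cycle. *)
Definition forest (T : finType) (F : graph T) : Prop :=
  ~ exists c : seq T, 3 <= size c /\ ucycle (adj F) c.

Definition has_2alternating_cycle (T : finType) (G : graph T) : Prop :=
  exists (n : nat) (c : (n.*2).-tuple T),
    [/\ 2 <= n, ucycle (adj G) c
      & forall i : 'I_(n.*2), ~~ odd i -> deg G (tnth c i) = 2].

Definition graph_class := forall T : finType, graph T -> Prop.

Definition hereditary (C : graph_class) : Prop :=
  forall (T : finType) (G H : graph T), C T G -> subgraph H G -> C T H.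

Definition edge_partition (T : finType) (G F1 F2 H : graph T) : Prop :=
  [/\ [&& subgraph F1 G, subgraph F2 G & subgraph H G],
      edges G = edges F1 :|: edges F2 :|: edges H
    & [&& [disjoint edges F1 & edges F2], [disjoint edges F1 & edges H]
        & [disjoint edges F2 & edges H]]].

(* Computed in rat and int, since d - alpha + 6 may be negative. *)
Definition forest_bound (alpha d : nat) : int :=
  Num.max 2%R (Num.ceil ((d%:R - alpha%:R + 6%:R) / 2%:R : rat)%R).

(* Main.v *)
(** Induct on the number of edges, encoding a partition as a colouring of the
    edges by [Some true], [Some false] (the forests) and [None] (the graph H).
    A pendant edge, or an edge uv with d(u) + d(v) <= alpha, is removed, and a
    degree count finds a colour with which it can be put back.  Otherwise the
    edges of a 2-alternating cycle are removed and put back alternately into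
    the two forests: each vertex of degree 2 becomes a leaf in both forests,
    and each other vertex v of the cycle gains 1 in each forest.  As no edge
    is light, d(v) >= alpha - 1, so the bound at v also grows by 1 when d(v)
    grows by 2. *)
Require Import Defs.
From HB Require Import structures.
From mathcomp Require Import all_boot all_order all_algebra.
From mathcomp Require Import zify lra.

Import Order.TTheory GRing.Theory Num.Theory.

Set Implicit Arguments.
Unset Strict Implicit.
Unset Printing Implicit Defensive.

(** * Neighbours and parity of positions along a cyclic sequence *)

Section Cycles.

Variable T : eqType.
Implicit Types (c : seq T) (x : T).

(** If the two neighbours agreed, two steps forward from x would return to x; with x rotated to the
    front, the third entry would repeat the first. *)
Lemma next_neq_prev c x :
  uniq c -> 2 < size c -> x \in c -> next c x != prev c x.
Proof.
move=> Uc sz_c xc; apply/eqP => eq_np.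
have : next c (next c x) = x by rewrite eq_np next_prev.
have [i c' def_c] := rot_to xc.
rewrite -(next_rot i Uc) -(next_rot i Uc) def_c.
have : uniq (rot i c) by rewrite rot_uniq.
have : 2 < size (rot i c) by rewrite size_rot.
rewrite def_c; case: c' {def_c} => [|y [|z c']] //= _.
rewrite !inE !negb_or eqxx => /andP[/and3P[xy xz _] _].
by rewrite eq_sym (negPf xy) eqxx => zx; rewrite zx eqxx in xz.
Qed.

Lemma odd_index_next c x : uniq c -> ~~ odd (size c) -> x \in c ->
  odd (index (next c x) c) = ~~ odd (index x c).
Proof.
move=> Uc even_c xc; rewrite next_nth xc.
case: c Uc even_c xc => // y c Uc even_c xc.
have : index x (y :: c) < size (y :: c) by rewrite index_mem.
move: (index x (y :: c)) => i; rewrite /= ltnS leq_eqVlt => /predU1P[->|lt_ic].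
  (* The last entry wraps round to index 0; its own index is odd because the size is even. *)
  by rewrite nth_default // eqxx; move: even_c => /= /negPn ->.
rewrite -[nth y c i]/(nth y (y :: c) i.+1).
by rewrite -[if _ then _ else _]/(index _ (y :: c)) index_uniq.
Qed.

Lemma odd_index_prev c x : uniq c -> ~~ odd (size c) -> x \in c ->
  odd (index (prev c x) c) = ~~ odd (index x c).
Proof.
move=> Uc even_c xc.
by rewrite -{2}(next_prev Uc x) odd_index_next ?mem_prev // negbK.
Qed.

End Cycles.

(** * Degrees and acyclicity of bare edge sets *)

Section EdgeSets.

Variable T : finType.
Implicit Types (E : {set {set T}}) (e : {set T}) (v : T).

Definition dg E v := #|[set e in E | v \in e]|.

Definition acyclic E :=
  ~ exists c : seq T, 3 <= size c /\ ucycle (fun u v => [set u; v] \in E) c.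

(** The map [u => [set v; u]] takes the neighbours of v onto the edges at v; it is injective on them
    since an edge has two elements, so that u differs from v. *)
Lemma deg_dg (G : graph T) v : deg G v = dg (edges G) v.
Proof.
have card2 e : e \in edges G -> #|e| = 2.
  by move=> eG; move/'forall_implyP: (edgesP G) => /(_ e eG)/andP[_ /eqP].
rewrite /deg /dg.
have neq u : adj G v u -> u != v.
  by move=> /card2; rewrite cards2 eq_sym; case: eqP.
rewrite -(card_in_imset (f := fun u => [set v; u])) => [|x y]; last first.
  rewrite !inE => /neq xv /neq yv /setP/(_ x).
  by rewrite !inE eqxx orbT (negPf xv) => /esym/eqP.
apply: eq_card => e; rewrite inE; apply/imsetP/andP => [[u]|[eG ve]].
  by rewrite inE => vu ->; rewrite set21.
have /eqP/cards2P[x [y [xy def_e]]] := card2 _ eG.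
move: ve; rewrite def_e !inE => /orP[/eqP->|/eqP->].
  by exists y; rewrite // inE /adj -def_e.
by exists x; rewrite 1?setUC // inE /adj setUC -def_e.
Qed.

Lemma dg_sub E1 E2 v : E1 \subset E2 -> dg E1 v <= dg E2 v.
Proof.
move=> sE; apply/subset_leq_card/subsetP => e.
by rewrite !inE => /andP[/(subsetP sE)-> ->].
Qed.

Lemma dgU E1 E2 v : dg (E1 :|: E2) v <= dg E1 v + dg E2 v.
Proof.
apply: leq_trans (leq_card_setU _ _); apply/subset_leq_card/subsetP => e.
by rewrite !inE andb_orl.
Qed.

Lemma dgID E E' v : dg E v = dg (E :&: E') v + dg (E :\: E') v.
Proof.
rewrite /dg -(cardsID E' [set e in E | v \in e]).
by congr (_ + _); apply: eq_card => e; rewrite !inE; do 3?case: (_ \in _).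
Qed.

Lemma dg_gt0 E e v : e \in E -> v \in e -> 0 < dg E v.
Proof. by move=> eE ve; apply/card_gt0P; exists e; rewrite inE eE. Qed.

Lemma dg_le1 E v :
  (forall e1 e2, e1 \in E -> e2 \in E -> v \in e1 -> v \in e2 -> e1 = e2) ->
  dg E v <= 1.
Proof.
move=> uniqE; rewrite leqNgt; apply/card_gt1P => -[e1 [e2 []]].
by rewrite !inE => /andP[? ?] /andP[? ?] /eqP[]; apply: uniqE.
Qed.

Lemma dg_setD1 E e v : e \in E -> dg E v = (v \in e) + dg (E :\ e) v.
Proof.
move=> eE; rewrite (dgID E [set e]); congr (_ + _).
have -> : E :&: [set e] = [set e] by apply/setIidPr; rewrite sub1set.
rewrite /dg; case: (boolP (v \in e)) => ve; last first.
  by apply: eq_card0 => x; rewrite !inE; case: eqP => // ->; rewrite (negPf ve).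
rewrite -[RHS](cards1 e); apply: eq_card => x.
by rewrite !inE; case: eqP => // ->; rewrite ve.
Qed.

Lemma dg_set1U E e v : dg (e |: E) v <= (v \in e) + dg E v.
Proof.
rewrite (@dg_setD1 _ e) ?setU11 // leq_add2l dg_sub //.
by rewrite subDset.
Qed.

Lemma acyclic0 : acyclic set0.
Proof.
by move=> [[|x [|y c]]] [] //= _ /andP[/= /andP[]]; rewrite inE.
Qed.

(* A vertex of degree at most 1 lies on no cycle. *)
Lemma acyclic_leaves E E' : acyclic E ->
  (forall e, e \in E' -> e \in E \/ exists2 v, v \in e & dg E' v <= 1) ->
  acyclic E'.
Proof.
move=> acE leafE [c [sz_c /andP[cyc Uc]]]; apply: acE; exists c; split=> //.
rewrite /ucycle Uc andbT; apply: cycle_from_next => // x xc.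
have [//|[v vx]] := leafE _ (next_cycle cyc xc).
have vc : v \in c.
  by move: vx; rewrite !inE => /orP[] /eqP->; rewrite ?mem_next.
move=> le1; have /negP[] := next_neq_prev Uc sz_c vc; apply/eqP.
have := next_cycle cyc vc; have := prev_cycle cyc vc; move=> Ep En.
(* Both cycle edges at v belong to E', so degree at most 1 makes them coincide. *)
have: [set v; next c v] = [set prev c v; v].
  apply: contraTeq le1 => neq; rewrite -ltnNge; apply/card_gt1P.
  by exists [set v; next c v], [set prev c v; v]; rewrite !inE Ep En !eqxx ?orbT.
move=> eqs; have := set22 v (next c v); rewrite eqs !inE.
case/orP => /eqP // nv; have := set21 (prev c v) v.
by rewrite -eqs nv !inE orbb => /eqP ->.
Qed.

End EdgeSets.

(** * Colourings of the edges and their extension by one edge *)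

Section Colourings.

Variables (T : finType) (alpha : nat).
Hypothesis alpha_ge5 : 5 <= alpha.
Implicit Types (E : {set {set T}}) (e : {set T}) (u v x : T).
Implicit Types (f : {set T} -> option bool) (c : seq T).

(** The ceiling of (d - alpha + 6) / 2 is the floor of (d + 7 - alpha) / 2; truncated subtraction
    only affects values below 2, which the maximum replaces. *)
Definition bound d := maxn 2 (d + 7 - alpha)./2.

Definition colour_class E f i := [set e in E | f e == i].

Definition good E f :=
  (forall b, acyclic (colour_class E f (Some b)) /\
    forall v, dg (colour_class E f (Some b)) v <= bound (dg E v)) /\
  forall v, dg (colour_class E f None) v <= alpha - 5.

Lemma bound_mono d1 d2 : d1 <= d2 -> bound d1 <= bound d2.
Proof. rewrite /bound; lia. Qed.

(** Once alpha <= d + 3, the second term of the maximum is at least 2, so it decides, and it grows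
    by 1 when d grows by 2. *)
Lemma bound_add2 d : alpha <= d + 3 -> bound d < bound (d + 2).
Proof. rewrite /bound; lia. Qed.

Lemma dg_colour E f v :
  dg E v = dg (colour_class E f (Some true)) v
    + dg (colour_class E f (Some false)) v + dg (colour_class E f None) v.
Proof.
rewrite (dgID E [set e | f e == Some true]).
rewrite (dgID (E :\: _) [set e | f e == Some false]) addnA.
by do 2?congr (_ + _); apply: eq_card => e; rewrite !inE;
  case: (f e) => [[]|]; rewrite ?andbT ?andbF.
Qed.

Definition recolour f e i := fun e' => if e' == e then i else f e'.

Lemma colour_class_recolour E f e i j : e \in E ->
  colour_class E (recolour f e i) j =
  if i == j then e |: colour_class (E :\ e) f j else colour_class (E :\ e) f j.
Proof.
move=> eE; apply/setP => x; rewrite (fun_if (fun A : {set _} => x \in A)) !inE.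
by rewrite /recolour; case: (eqVneq x e) => [->|_]; rewrite ?eE //=; case: ifP.
Qed.

(** An end of e that the forest misses becomes a leaf, so e closes no cycle; the degree bounds can
    only fail at the ends of e, where there is room. *)
Lemma good_recolour E f e i : e \in E -> good (E :\ e) f ->
  (forall v, v \in e -> dg (colour_class (E :\ e) f i) v
     < if i is None then alpha - 5 else bound (dg E v)) ->
  (i <> None -> exists2 v, v \in e & dg (colour_class (E :\ e) f i) v = 0) ->
  good E (recolour f e i).
Proof.
move=> eE [goodF goodH] room leaf.
have le_bound v : bound (dg (E :\ e) v) <= bound (dg E v).
  by rewrite bound_mono // dg_sub // subD1set.
split=> [b|v]; last first.
  rewrite colour_class_recolour //; case: eqP => [eq_i|_]; last exact: goodH.
  rewrite eq_i in room; apply: leq_trans (dg_set1U _ _ _) _.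
  by case: (boolP (v \in e)) => [/room|_] //; apply: goodH.
have [acF dgF] := goodF b; rewrite colour_class_recolour //.
case: eqP => [eq_i|_]; last first.
  by split=> // v; apply: leq_trans (dgF v) _.
rewrite eq_i in room leaf; split=> [|v]; last first.
  apply: leq_trans (dg_set1U _ _ _) _.
  case: (boolP (v \in e)) => [/room //|_].
  exact: leq_trans (dgF v) _.
apply: acyclic_leaves acF _ => x; rewrite in_setU1 => /predU1P[->|]; last by left.
have [//|v ve dg0] := leaf; right; exists v => //.
by apply: leq_trans (dg_set1U _ _ _) _; rewrite dg0 addn0 leq_b1.
Qed.

(** The choice of a colour for uv becomes one boolean condition on the degrees of u and v, fit for
    [lia]. *)
Lemma good_edge E f u v (dgf := fun i => dg (colour_class (E :\ [set u; v]) f i))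
    (fits := fun b => [&& (dgf (Some b) u == 0) || (dgf (Some b) v == 0),
      dgf (Some b) u < bound (dg E u) & dgf (Some b) v < bound (dg E v)]) :
  [set u; v] \in E -> good (E :\ [set u; v]) f ->
  [|| fits true, fits false
    | (dgf None u < alpha - 5) && (dgf None v < alpha - 5)] ->
  exists f', good E f'.
Proof.
move=> eE gf.
have fitsP b : fits b -> exists f', good E f'.
  case/and3P => leaf room_u room_v.
  exists (recolour f [set u; v] (Some b)); apply: good_recolour => // [x|_].
    by rewrite !inE => /orP[]/eqP->.
  by case/orP: leaf => /eqP; [exists u | exists v]; rewrite ?set21 ?set22.
case/or3P => [/fitsP //|/fitsP //|/andP[room_u room_v]].
exists (recolour f [set u; v] None); apply: good_recolour => // x.
by rewrite !inE => /orP[]/eqP->.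
Qed.

Lemma dg_edgeD1 E f u v (e := [set u; v]) : e \in E ->
  {in e, forall x, dg E x = (dg (colour_class (E :\ e) f (Some true)) x
    + dg (colour_class (E :\ e) f (Some false)) x
    + dg (colour_class (E :\ e) f None) x).+1}.
Proof. by move=> eE x xe; rewrite -dg_colour (@dg_setD1 _ E e) // xe. Qed.

(** No other edge meets v, so only room at u matters. If all three colours were full at u, they
    would hold at least 2 * bound + (alpha - 5) >= d(u) + 1 edges there, but only d(u) - 1 remain
    besides uv. *)
Lemma good_pendant E f u v : [set u; v] \in E -> dg E v = 1 ->
  good (E :\ [set u; v]) f -> exists f', good E f'.
Proof.
move=> eE dgv gf; apply: (good_edge eE gf).
have := dg_edgeD1 f eE (set21 u v); have := dg_edgeD1 f eE (set22 u v).
rewrite dgv /bound /=; lia.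
Qed.

(** A forest that cannot take uv has at least two edge ends at u and v together, because its bound
    is at least 2; an H that cannot has at least alpha - 5. Three failures need alpha - 1 ends, but
    at most alpha - 2 remain besides uv. *)
Lemma good_light E f u v : [set u; v] \in E -> dg E u + dg E v <= alpha ->
  good (E :\ [set u; v]) f -> exists f', good E f'.
Proof.
move=> eE light gf; apply: (good_edge eE gf); have [_ dgH] := gf.
have := dgH u; have := dgH v.
have := dg_edgeD1 f eE (set21 u v); have := dg_edgeD1 f eE (set22 u v).
rewrite /bound /=; lia.
Qed.

(** * Putting back the edges of a 2-alternating cycle *)

Section AlternatingCycle.

Variables (E : {set {set T}}) (c : seq T).
Hypotheses (Uc : uniq c) (sz_c : 2 < size c) (even_c : ~~ odd (size c)).
Hypothesis cyc : cycle (fun u v => [set u; v] \in E) c.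

Let evens := [set x in c | ~~ odd (index x c)].
Let step (b : bool) := if b then next c else prev c.

(** Each edge of the even cycle joins a vertex of even index to its successor or predecessor; b
    tells which, and later which forest receives the edge. *)
Definition alternate_edges b := [set [set x; step b x] | x in evens].

Let stepK b : cancel (step b) (step (~~ b)).
Proof. by case: b => x; rewrite /step /= ?next_prev ?prev_next. Qed.

Let step_mem b x : (step b x \in c) = (x \in c).
Proof. by case: b; rewrite /step /= ?mem_next ?mem_prev. Qed.

Let step_evens b x : x \in c -> (step b x \in evens) = (x \notin evens).
Proof.
move=> xc; rewrite !inE step_mem xc /= negbK.
by case: b; rewrite /step /= ?odd_index_next ?odd_index_prev // negbK.
Qed.

Let evens_c x : x \in evens -> x \in c.
Proof. by rewrite inE => /andP[]. Qed.

(** Each half is a perfect matching of the cycle, since [step b] is injective and exchanges even and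
    odd positions. *)
Lemma dg_alternate_edges b v : dg (alternate_edges b) v = (v \in c).
Proof.
case: (boolP (v \in c)) => vc; last first.
  apply: eq_card0 => e; rewrite inE; apply/andP => -[/imsetP[x /evens_c xc ->]].
  by rewrite !inE => /orP[]/eqP v_x; rewrite v_x ?step_mem xc in vc.
apply/eqP; rewrite eqn_leq; apply/andP; split.
  apply: dg_le1 => _ _ /imsetP[x xA ->] /imsetP[y yA ->].
  have sx := step_evens b (evens_c xA); have sy := step_evens b (evens_c yA).
  rewrite xA in sx; rewrite yA in sy; rewrite !inE.
  case/orP => /eqP-> /orP[] /eqP eq_v; first by rewrite eq_v.
  - by rewrite eq_v sy in xA.
  - by rewrite -eq_v sx in yA.
  - by rewrite (can_inj (stepK b) eq_v).
case: (boolP (v \in evens)) => vA.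
  apply: (@dg_gt0 _ _ [set v; step b v]); last exact: set21.
  exact: (imset_f (fun x => [set x; step b x])).
apply: (@dg_gt0 _ _ [set step (~~ b) v; v]); rewrite ?set22 //.
rewrite -{2}[v](stepK (~~ b)) negbK.
by apply: (imset_f (fun x => [set x; step b x])); rewrite step_evens.
Qed.

(** A common edge would have the same even end x in both halves, hence join x to a vertex that is
    both its successor and its predecessor. *)
Lemma disjoint_alternate_edges :
  [disjoint alternate_edges true & alternate_edges false].
Proof.
rewrite -setI_eq0; apply/set0Pn => -[e]; rewrite inE => /andP[].
case/imsetP => x xA -> /imsetP[y yA eq_xy].
have sxA b : step b x \notin evens by rewrite step_evens ?xA ?evens_c.
have def_y : y = x.
  have := set21 x (next c x); rewrite eq_xy !inE => /orP[/eqP->//|/eqP def_x].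
  by move: xA; rewrite def_x step_evens ?yA ?evens_c.
have := set22 x (next c x); rewrite eq_xy def_y !inE.
rewrite (negPf (next_neq_prev Uc sz_c (evens_c xA))) orbF => /eqP nx.
by have := sxA true; rewrite /step /= nx xA.
Qed.

Lemma alternate_edges_sub b : alternate_edges b \subset E.
Proof.
apply/subsetP => _ /imsetP[x /evens_c xc ->]; case: b.
  exact: next_cycle cyc xc.
by rewrite setUC; apply: prev_cycle cyc xc.
Qed.

Definition off_cycle :=
  E :\: (alternate_edges true :|: alternate_edges false).

Lemma dg_off_cycle v : dg E v = dg off_cycle v + (v \in c).*2.
Proof.
rewrite (dgID E (alternate_edges true :|: alternate_edges false)) addnC.
congr (_ + _); rewrite -addnn -{1}(dg_alternate_edges true).
rewrite -(dg_alternate_edges false).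
rewrite (setIidPr _) ?subUset ?alternate_edges_sub //.
rewrite (dgID (_ :|: _) (alternate_edges true)) setUK setDUl setDv set0U.
congr (_ + dg _ v); apply/setDidPl.
by rewrite disjoint_sym disjoint_alternate_edges.
Qed.

Lemma good_alternating f :
  {in evens, forall x, dg E x = 2} ->
  (forall u v, [set u; v] \in E -> alpha < dg E u + dg E v) ->
  good off_cycle f -> exists f', good E f'.
Proof.
move=> dg2 heavy [goodF goodH].
pose f' e := if e \in alternate_edges true then Some true
             else if e \in alternate_edges false then Some false else f e.
have sub_None : colour_class E f' None \subset colour_class off_cycle f None.
  apply/subsetP => e; rewrite !inE /f' => /andP[->].
  by case: ifP => // _; case: ifP.
have sub_Some b : colour_class E f' (Some b)
    \subset alternate_edges b :|: colour_class off_cycle f (Some b).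
  apply/subsetP => e; rewrite !inE /f' => /andP[->].
  by case: b; case: (e \in alternate_edges true);
    case: (e \in alternate_edges false).
exists f'; split=> [b|v]; last exact: leq_trans (dg_sub _ sub_None) (goodH v).
have [acF dgF] := goodF b.
have le_dg v : dg (colour_class E f' (Some b)) v
    <= (v \in c) + dg (colour_class off_cycle f (Some b)) v.
  rewrite -(dg_alternate_edges b).
  exact: leq_trans (dg_sub _ (sub_Some b)) (dgU _ _ _).
(* A vertex of degree 2 has both its edges on the cycle, so only its matching edge can have colour
   b. *)
have le_evens v : v \in evens -> dg (colour_class E f' (Some b)) v <= 1.
  move=> vA; apply: leq_trans (le_dg v) _; rewrite evens_c //.
  have : dg (colour_class off_cycle f (Some b)) v <= dg off_cycle v.
    by apply: dg_sub; apply/subsetP => e; rewrite inE => /andP[].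
  have := dg_off_cycle v; rewrite dg2 // evens_c //=; lia.
split=> [|v].
  apply: acyclic_leaves acF _ => e /(subsetP (sub_Some b)).
  case/setUP => [/imsetP[x xA ->]|]; last by left.
  by right; exists x; rewrite ?set21 // le_evens.
case: (boolP (v \in evens)) => vA.
  by apply: leq_trans (le_evens v vA) _; rewrite leq_max.
apply: leq_trans (le_dg v) _; have := dgF v; have := dg_off_cycle v.
case: (boolP (v \in c)) => vc /=; last by rewrite addn0 => ->.
(* Here v has odd index and its predecessor has degree 2. Their edge is not light, so with d the
   degree of v off the cycle, alpha < 2 + (d + 2), as [bound_add2] requires. *)
have xA : prev c v \in evens by rewrite (step_evens false).
have := heavy _ _ (prev_cycle cyc vc); rewrite dg2 // => + def_d.
rewrite def_d => hv le_d; apply: leq_trans (bound_add2 _); rewrite ?ltnS //.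
lia.
Qed.

End AlternatingCycle.

(** The three alternatives are asked of every nonempty subset because the induction descends to
    subsets. An edge set shows no isolated vertices, so the first alternative asks for degree
    exactly 1. *)
Lemma exists_good E :
  (forall e, e \in E -> #|e| = 2) ->
  (forall E', E' \subset E -> E' != set0 ->
    [\/ exists v, dg E' v = 1,
        exists u v, [set u; v] \in E' /\ dg E' u + dg E' v <= alpha
      | exists c, [/\ uniq c, 2 < size c, ~~ odd (size c),
          cycle (fun u v => [set u; v] \in E') c
        & {in [set x in c | ~~ odd (index x c)], forall x, dg E' x = 2}]]) ->
  exists f, good E f.
Proof.
have [n] := ubnP #|E|; elim: n E => // n IHn E leEn card2 structE.
have [->|E0] := eqVneq E set0.
  have dg0 i v : dg (colour_class set0 (fun=> None) i) v = 0.
    by apply: eq_card0 => e; rewrite !inE.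
  exists (fun=> None); split=> [b|v]; rewrite ?dg0 //.
  split=> [|v]; last by rewrite dg0.
  have -> : colour_class set0 (fun=> None) (Some b) = set0.
    by apply/setP => e; rewrite !inE.
  exact: acyclic0.
have IH E' : E' \proper E -> exists f, good E' f.
  move=> E'E; have sE'E := proper_sub E'E; apply: IHn.
  - exact: leq_trans (proper_card E'E) _.
  - by move=> e /(subsetP sE'E)/card2.
  - by move=> E'' sE''; apply: structE; apply: subset_trans sE'E.
have remove e : e \in E -> exists f, good (E :\ e) f.
  by move=> eE; apply/IH/properD1.
(* Light edges are treated before [structE] is used, because the cycle case needs that no edge of E
   is light. *)
case: (boolP [exists u, exists v, ([set u; v] \in E) &&
                (dg E u + dg E v <= alpha)]).
  case/existsP => u /existsP[v /andP[eE light]].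
  by have [f] := remove _ eE; apply: good_light.
move=> /existsPn heavy.
have heavyE u v : [set u; v] \in E -> alpha < dg E u + dg E v.
  by move=> eE; move: (heavy u) => /existsPn/(_ v); rewrite eE /= ltnNge.
have [[v dgv]|[u [v [eE]]]|[c [Uc sz_c even_c cyc dg2]]] := structE E (subxx _) E0.
- have : 0 < dg E v by rewrite dgv.
  case/card_gt0P => e; rewrite inE => /andP[eE ve].
  have /eqP/cards2P[x [y [_ def_e]]] := card2 _ eE.
  have [u def_e'] : exists u, e = [set u; v].
    move: ve; rewrite def_e !inE => /orP[]/eqP->; last by exists x.
    by exists y; rewrite setUC.
  rewrite {}def_e' {def_e} in eE ve.
  by have [f] := remove _ eE; apply: good_pendant.
- by rewrite leqNgt heavyE.
have [|f] := IH (off_cycle E c); last exact: good_alternating.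
(* The first vertex of c loses degree 2, so [off_cycle] is not all of E. *)
rewrite properE subsetDl; apply/negP => sE.
case: c => // x c in Uc sz_c even_c cyc dg2 sE *.
have := dg_off_cycle Uc sz_c even_c cyc x; rewrite inE eqxx /=.
by have := dg_sub x sE; lia.
Qed.

End Colourings.

(** * From edge sets back to graphs *)

Lemma min_deg_le1 (T : finType) (G : graph T) :
  1 < #|vertices G| -> min_deg G <= 1 ->
  exists2 v, v \in vertices G & deg G v <= 1.
Proof.
move=> gtV le1; apply/exists_inP; apply: contraLR le1.
rewrite negb_exists_in -ltnNge => /forall_inP gt1.
(* The default value of the minimum is the number of vertices, which exceeds 1 as well. *)
rewrite /min_deg; elim/big_ind: _ => // [x y x1 y1|v /gt1].
  by rewrite leq_min x1.
by rewrite ltnNge.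
Qed.

Lemma bound_forest_bound alpha d :
  ((bound alpha d)%:Z <= forest_bound alpha d)%R.
Proof.
rewrite /bound /forest_bound le_max.
case: leqP => [le2|_]; [apply/orP; right | by []].
set n := _./2 in le2 *.
(* Since n >= 2, the subtraction inside n is not truncated. *)
have n_le : n.*2 + alpha <= d + 7 by lia.
(* For an integer n, n <= ceil x amounts to n - 1 < x. *)
rewrite -[Posz n](subrK 1%R) lezD1 ceil_gt_int.
rewrite rmorphB /= -!pmulrn.
move: n_le; rewrite -addnn -(ler_nat rat) !natrD => n_le.
by lra.
Qed.

Theorem theorem4 (alpha : nat) (C : graph_class)
    (halpha : 5 <= alpha) (hereditaryC : hereditary C)
    (hC : forall (T : finType) (G : graph T), C T G ->
       [\/ min_deg G <= 1,
           exists u v : T, adj G u v /\ deg G u + deg G v <= alpha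
         | has_2alternating_cycle G])
    (T : finType) (G : graph T) (hG : C T G) :
  exists F1 F2 H : graph T,
    [/\ edge_partition G F1 F2 H,
        forest F1 /\ forest F2,
        forall v : T, v \in vertices F1 ->
          ((deg F1 v)%:Z <= forest_bound alpha (deg G v))%R,
        forall v : T, v \in vertices F2 ->
          ((deg F2 v)%:Z <= forest_bound alpha (deg G v))%R
      & max_deg H <= alpha - 5].
Proof.
have edgeG e : e \in edges G -> e \subset vertices G /\ #|e| = 2.
  by move=> eG; move/forall_inP: (edgesP G) => /(_ e eG)/andP[-> /eqP].
have [|E' sE E'0|f [goodF goodH]] := @exists_good T alpha halpha (edges G).
- by move=> e /edgeG[].
(* With [cover E'] as vertex set, no vertex is isolated, so a vertex of degree at most 1 has degree
   1. *)
- have GP : [forall e in E', (e \subset cover E') && (#|e| == 2)].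
    apply/forall_inP => e eE'; have [_ ->] := edgeG e (subsetP sE _ eE').
    by rewrite eqxx andbT; apply: bigcup_sup.
  pose G' := Graph GP.
  have CG' : C T G'.
    apply: hereditaryC hG _; rewrite /subgraph sE andbT.
    by apply/bigcupsP => e /(subsetP sE)/edgeG[].
  have degG' v : deg G' v = dg E' v by apply: deg_dg.
  have [le1|[u [v [uv light]]]|[n [c [n2 /andP[cyc Uc] deg2]]]] := hC _ _ CG'.
  + constructor 1.
    have [|v /bigcupP[e eE' ve]] := min_deg_le1 _ le1.
      have [e eE'] := set0Pn _ E'0.
      have [_ <-] := edgeG e (subsetP sE _ eE').
      exact/subset_leq_card/bigcup_sup.
    rewrite degG' => dgv; exists v; apply/eqP.
    by rewrite eqn_leq dgv (dg_gt0 eE' ve).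
  + by constructor 2; exists u, v; rewrite -!degG'.
  constructor 3; exists c; rewrite size_tuple odd_double; split=> //.
    by rewrite -addnn; lia.
  move=> x; rewrite inE => /andP[xc even_x].
  have ltx : index x c < n.*2 by rewrite -[X in _ < X](size_tuple c) index_mem.
  have := deg2 (Ordinal ltx) even_x.
  by rewrite (tnth_nth x) /= nth_index // degG'.
have sub_class i : colour_class (edges G) f i \subset edges G.
  by apply/subsetP => e; rewrite inE => /andP[].
have classP i : [forall e in colour_class (edges G) f i,
    (e \subset vertices G) && (#|e| == 2)].
  by apply/forall_inP => e /(subsetP (sub_class i))/edgeG[-> ->].
have disj i j : i != j ->
    [disjoint colour_class (edges G) f i & colour_class (edges G) f j].
  move=> neq_ij; rewrite -setI_eq0; apply/set0Pn => -[e].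
  by rewrite !inE => /andP[/andP[_ /eqP->]] /andP[_]; apply/negP.
pose F i := Graph (classP i).
have dgF b v : ((deg (F (Some b)) v)%:Z <= forest_bound alpha (deg G v))%R.
  apply: le_trans (bound_forest_bound _ _).
  by rewrite !deg_dg; apply: (goodF b).2.
exists (F (Some true)), (F (Some false)), (F None); split=> //.
- rewrite /edge_partition /subgraph !subxx !sub_class !disj //; split=> //.
  apply/setP => e; rewrite !inE -!andb_orr.
  by case: (f e) => [[]|]; rewrite andbT.
- by split; [apply: (goodF true).1 | apply: (goodF false).1].
by apply/bigmax_leqP => v _; rewrite deg_dg.
Qed.
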